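(* Let $(X,d,T)$ and $(Y,d',S)$ be topological dynamical systems, let $\mu$ be a $T$-invariant Borel probability measure on $X$ and $\nu$ an $S$-invariant Borel probability measure on $Y$. Assume $(X,\mathcal{B}(X),T,\mu)$ is measurably isomorphic to $(Y,\mathcal{B}(Y),S,\nu)$, and let $U:\mathbb{N}\to[1,+\infty)$ be an increasing sequence with $\lim_{n\to+\infty}U(n)=+\infty$. Then the measure FK-complexity of $(X,d,T,\mu)$ is weaker than $U(n)$ if and only if the measure FK-complexity of $(Y,d',S,\nu)$ is weaker than $U(n)$.
   Context: A topological dynamical system $(X,d,T)$ consists of a compact metric space $X$ with metric $d$ and a continuous map $T:X\to X$. $\mathcal{B}(X)$ is the Borel $\sigma$-algebra of $X$. For $x,y\in X$, $\delta>0$ and $n\in\mathbb{N}$, an $(n,\delta)$-match of $x$ and $y$ is an order preserving bijection $\pi:D(\pi)\to R(\pi)$ (i.e. $\pi(i)<\pi(j)$ whenever $i<j$) with $D(\pi),R(\pi)\subset\{0,1,\ldots,n-1\}$ such that $d(T^ix,T^{\pi(i)}y)<\delta$ for every $i\in D(\pi)$. Let $|\pi|$ be the cardinality of $D(\pi)$. Set $$\bar f_{n,\delta}(x,y)=1-\frac{\max\{|\pi|:\pi\text{ is an }(n,\delta)\text{-match of }x\text{ and }y\}}{n},\qquad d_{FK_n}(x,y)=\inf\{\delta>0:\bar f_{n,\delta}(x,y)<\delta\},$$ and $B_{d_{FK_n}}(x,\epsilon)=\{y\in X:d_{FK_n}(x,y)<\epsilon\}$. For $n\in\mathbb{N}$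 and $\epsilon>0$, $$sp_{FK}(d,\mu,n,\epsilon)=\min\Big\{m\in\mathbb{N}:\exists\,x_1,\ldots,x_m\in X\text{ such that }\mu\Big(\bigcup_{i=1}^m B_{d_{FK_n}}(x_i,\epsilon)\Big)>1-\epsilon\Big\}.$$ The same definitions apply to $(Y,d',S,\nu)$, with $d'$ and $S$ in place of $d$ and $T$. The measure FK-complexity of $(X,d,T,\mu)$ is weaker than $U(n)$ if $\liminf_{n\to+\infty}\frac{sp_{FK}(d,\mu,n,\epsilon)}{U(n)}=0$ for every $\epsilon>0$. Measurably isomorphic means: there are $X'\in\mathcal{B}(X)$, $Y'\in\mathcal{B}(Y)$ with $\mu(X')=1$, $\nu(Y')=1$, $TX'\subseteq X'$, $SY'\subseteq Y'$, and an invertible measure-preserving map $\phi:X'\to Y'$ with $\phi\circ T(x)=S\circ\phi(x)$ for every $x\in X'$. *)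

(* Defs.v *)
From HB Require Import structures.
From mathcomp Require Import all_boot all_order all_algebra.
From mathcomp Require Import all_classical all_reals all_analysis.

Set Implicit Arguments.
Unset Strict Implicit.
Unset Printing Implicit Defensive.

Import Order.TTheory GRing.Theory Num.Theory.
Import numFieldNormedType.Exports.

Local Open Scope classical_set_scope.
Local Open Scope ring_scope.

(* [g_sigma_algebraType] only takes pointed types. Asking for a point loses
   nothing here: a space that carries a probability measure is nonempty. *)
#[short(type="pmetricType")]
HB.structure Definition PointedMetric (K : numDomainType) :=
  {M of Metric K M & Pointed M}.

Notation borel X := (g_sigma_algebraType (@open X)).

Section FK_pseudometric.
Context {R : realType} {X : pmetricType R}.
Variable T : X -> X.

(* A match is encoded by its domain [D] and a function [p] on {0, .., n-1}
   whose values outside [D] are irrelevant; its range is [p @: D]. *)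
Definition is_match (n : nat) (delta : R) (x y : X)
    (D : {set 'I_n}) (p : {ffun 'I_n -> 'I_n}) : bool :=
  [forall i in D, forall j in D, (i < j)%N ==> (p i < p j)%N] &&
  [forall i in D, mdist (iter i T x) (iter (p i) T y) < delta].

Definition max_match (n : nat) (delta : R) (x y : X) : nat :=
  \max_(m : {set 'I_n} * {ffun 'I_n -> 'I_n} | is_match delta x y m.1 m.2)
    #|m.1|.

(* These notions are meant for n >= 1; the value at n = 0 is junk, which does
   not affect the lower limit in [FK_weaker_than]. *)
Definition fbar (n : nat) (delta : R) (x y : X) : R :=
  1 - (max_match n delta x y)%:R / n%:R.

Definition dFK (n : nat) (x y : X) : R :=
  inf [set delta : R | 0 < delta /\ fbar n delta x y < delta].

Definition ballFK (n : nat) (x : X) (eps : R) : set X :=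
  [set y | dFK n x y < eps].

End FK_pseudometric.

Section measure_FK_complexity.
Context {R : realType} {X : pmetricType R}.
Variables (T : X -> X) (mu : probability (borel X) R).

Definition FK_spanned_by (n : nat) (eps : R) (m : nat) : Prop :=
  (0 < m)%N /\ exists x : 'I_m -> X,
    ((1 - eps)%:E < mu (\bigcup_i ballFK T n (x i) eps))%E.

(* An infimum of natural numbers, hence a minimum as soon as the set is
   nonempty; an empty set would give +oo. *)
Definition spFK (n : nat) (eps : R) : \bar R :=
  ereal_inf [set m%:R%:E | m in FK_spanned_by n eps].

Definition FK_weaker_than (U : nat -> R) : Prop :=
  forall eps : R, 0 < eps ->
    limn_einf (fun n => spFK n eps * ((U n)^-1)%:E)%E = 0%E.

End measure_FK_complexity.

Definition invariant_measure {d} {E : measurableType d} {R : realType}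
    (T : E -> E) (mu : probability E R) : Prop :=
  forall A : set E, measurable A -> mu (T @^-1` A) = mu A.

Section isomorphism.
Context {d d' : measure_display} {E : measurableType d} {F : measurableType d'}.
Context {R : realType}.

(* [f], restricted to [A] and [B] with their trace sigma-algebras, is measurable
   and measure preserving. *)
Definition measure_preserving_on (mu : set E -> \bar R) (nu : set F -> \bar R)
    (A : set E) (B : set F) (f : E -> F) : Prop :=
  [/\ set_fun A B f, measurable_fun A f &
      forall C : set F, measurable C -> C `<=` B ->
        mu (A `&` f @^-1` C) = nu C].

End isomorphism.

Definition measurably_isomorphic {d d' : measure_display}
    {E : measurableType d} {F : measurableType d'} {R : realType}
    (T : E -> E) (mu : probability E R) (S : F -> F) (nu : probability F R)
    : Prop :=
  exists (E' : set E) (F' : set F),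
    [/\ measurable E' /\ measurable F',
        mu E' = 1%E /\ nu F' = 1%E,
        T @` E' `<=` E' /\ S @` F' `<=` F' &
        exists (phi : E -> F) (psi : F -> E),
          [/\ measure_preserving_on mu nu E' F' phi,
              measure_preserving_on nu mu F' E' psi,
              {in E', cancel phi psi}, {in F', cancel psi phi} &
              {in E', forall x, phi (T x) = S (phi x)}]].

(* Main.v *)
Require Import Defs.
From HB Require Import structures.
From mathcomp Require Import all_boot all_order all_algebra.
From mathcomp Require Import all_classical all_reals all_analysis.
From mathcomp Require Import measurable_realfun lra.

(** By symmetry of isomorphism it is enough to bound the complexity of [Y] by
    that of [X]: for every [e > 0] there is [e' > 0] such that, for all [n >= 1],
    any number of FK-balls of radius [e'] that suffices to cover most of [X]
    also suffices, at radius [e], for [Y] ([FK_spanned_transfer]). Then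
    [spFK S nu n e <= spFK T mu n e'] for [n >= 1], and a lower limit equal to
    zero passes from [X] to [Y].

    Let [phi] be the isomorphism, and suppose first that it is uniformly
    continuous: [mdist x y < dl] implies [mdist (phi x) (phi y) < e / 2]. Then
    [phi] turns a match of two orbits at scale [dl] into a match of their images
    at scale [e / 2]. In general [phi] is only measurable, and this implication
    holds for [x], [y] in a set [K] with [mu (~` K)] arbitrarily small
    ([almost_uniformly_close], a form of Lusin's theorem). Matches tolerate
    this, because an FK-match may drop a small proportion of the times. By
    invariance of [mu], the expected proportion of times that an orbit segment of
    length [n] spends outside [K] is [mu (~` K)], so by Markov's inequality all
    points outside a set of small measure spend a small proportion [th] of their
    time outside [K], uniformly in [n] ([measure_many_visits]).

    The centres of the balls in [X] need not be such good points. Each centre [c]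
    is therefore replaced by a good point [z] of its ball, and a good point [x] of
    the same ball is compared with [z] through [c]: matches [c -> z] and
    [c -> x] of size at least [(1 - e') n], restricted to the common times at
    which both image points are in [K], give a match of [phi z] with [phi x] of
    size at least [(1 - 2 e' - 2 th) n] ([dFK_transfer]). Hence [phi x] is in the
    ball of radius [e] around [phi z].

    The sets whose measures are compared are measurable because FK-balls are
    open ([open_ballFK]). *)

Set Implicit Arguments.
Unset Strict Implicit.
Unset Printing Implicit Defensive.

Import Order.TTheory GRing.Theory Num.Theory.
Import numFieldNormedType.Exports.

Local Open Scope classical_set_scope.
Local Open Scope ring_scope.

(** * Matches and FK-balls *)

Section matches.
Context {R : realType} {X : pmetricType R}.
Variable T : X -> X.

Lemma is_matchP n (d : R) (x y : X) (D : {set 'I_n}) (p : {ffun 'I_n -> 'I_n}) :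
  reflect ({in D &, forall i j : 'I_n, (i < j)%N -> (p i < p j)%N} /\
           {in D, forall i : 'I_n, mdist (iter i T x) (iter (p i) T y) < d})
          (is_match T d x y D p).
Proof.
apply: (iffP andP) => -[h1 h2]; split.
- move=> i j iD jD ij.
  by move/forall_inP/(_ i iD)/forall_inP/(_ j jD)/implyP: h1 => /(_ ij).
- by move=> i iD; move/forall_inP/(_ i iD): h2.
- by apply/forall_inP => i iD; apply/forall_inP => j jD; apply/implyP; exact: h1.
- by apply/forall_inP.
Qed.

Lemma max_match_attained n (d : R) (x y : X) :
  exists (D : {set 'I_n}) (p : {ffun 'I_n -> 'I_n}),
    is_match T d x y D p /\ #|D| = max_match T n d x y.
Proof.
pose P := [pred m : {set 'I_n} * {ffun 'I_n -> 'I_n} | is_match T d x y m.1 m.2].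
have P0 : (0 < #|P|)%N.
  apply/card_gt0P; exists (finset.set0, [ffun i => i]).
  rewrite inE; apply/is_matchP; split => [i j|i] /=; by rewrite inE.
have [[D p] mDp e] := eq_bigmax_cond
  (fun m : {set 'I_n} * {ffun 'I_n -> 'I_n} => #|m.1|) P0.
by exists D, p; split => //; rewrite /max_match -e.
Qed.

(** The infimum and the maximum are replaced by one witness: the infimum is over
    a nonempty set (it contains 2, as [fbar <= 1]), and the maximum over matches
    is attained. *)
Lemma dFK_ltP n (x y : X) (e : R) : (0 < n)%N ->
  dFK T n x y < e <->
  exists (d : R) (D : {set 'I_n}) (p : {ffun 'I_n -> 'I_n}),
    [/\ 0 < d, d < e, is_match T d x y D p & (1 - d) * n%:R < #|D|%:R].
Proof.
move=> n0; have n0R : 0 < n%:R :> R by rewrite ltr0n.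
have fbarE d : (fbar T n d x y < d) = ((1 - d) * n%:R < (max_match T n d x y)%:R).
  by rewrite /fbar -ltr_pdivlMr// ltrBlDr ltrBlDl.
split.
- move/inf_lt => [].
    exists 2 => /=; split => //; rewrite fbarE.
    by apply: (@lt_le_trans _ _ 0) => //; nra.
  move=> d [d0]; rewrite fbarE => h de.
  have [D [p [m c]]] := max_match_attained n d x y.
  by exists d, D, p; rewrite c.
- move=> [d [D [p [d0 de m c]]]]; apply: le_lt_trans de.
  apply: ge_inf; first by exists 0 => z /= [/ltW].
  split => //; rewrite fbarE; apply: lt_le_trans c _; rewrite ler_nat.
  exact: (@leq_bigmax_cond _ (fun m => is_match T d x y m.1 m.2)
    (fun m => #|m.1|) (D, p)).
Qed.

Lemma continuous_iter k : continuous T -> continuous (iter k T).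
Proof.
move=> cT; elim: k => [|k IH] x /=; first exact: cvg_id.
by apply: (@continuous_comp _ _ _ (iter k T) T); [exact: IH|exact: cT].
Qed.

Lemma open_mdist_lt (x : X) (d : R) : open [set y | mdist x y < d].
Proof.
rewrite openE => y /= xy; apply/nbhs_ballP; exists (d - mdist x y) => /=.
  by rewrite subr_gt0.
rewrite ballEmdist => z /=; rewrite ltrBrDl; apply: le_lt_trans; exact: metric_triangle.
Qed.

(** A match that witnesses [dFK T n x y < e] consists of finitely many strict
    inequalities on iterates of [y], so it also works for all points near [y]. *)
Lemma open_ballFK n (x : X) (e : R) : (0 < n)%N -> continuous T ->
  open (ballFK T n x e).
Proof.
move=> n0 cT; rewrite openE => y /(dFK_ltP _ _ _ n0)[d [D [p [d0 de m c]]]].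
have [mono md] := is_matchP _ _ _ _ _ m.
have : \forall z \near y, forall i : 'I_n, i \in D ->
    mdist (iter i T x) (iter (p i) T z) < d.
  apply: filter_forall => i; have [iD|/negP iD] := boolP (i \in D); last first.
    by apply: nearW => z iD'; case: iD.
  have yB : nbhs (iter (p i) T y) [set w | mdist (iter i T x) w < d].
    by apply: open_nbhs_nbhs; split; [exact: open_mdist_lt|exact: md].
  near=> z => _; near: z; exact: (@continuous_iter (p i) cT y _ yB).
apply: filterS => z zd; apply/(dFK_ltP _ _ _ n0); exists d, D, p; split => //.
by apply/is_matchP; split.
Unshelve. all: by end_near. Qed.

End matches.

Lemma ord_mono_inj n (D : {set 'I_n}) (p : 'I_n -> 'I_n) :
  {in D &, forall i j : 'I_n, (i < j)%N -> (p i < p j)%N} -> {in D &, injective p}.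
Proof.
move=> mono i j iD jD pij.
have h (k l : 'I_n) : k \in D -> l \in D -> p k = p l -> (k < l)%N -> False.
  by move=> kD lD pkl kl; have := mono _ _ kD lD kl; rewrite pkl ltnn.
case: (ltngtP i j) => [ij|ji|/val_inj//].
- by case: (h i j).
- by case: (h j i).
Qed.

(** Two order-preserving maps [p], [q] out of the same set of times [C] describe
    the pairs [(p i, q i)] of an order-preserving matching, namely [q] composed
    with the inverse of [p] on [p @: C]. *)
Lemma match_cospan {R : realType} {Y : pmetricType R} (S : Y -> Y) n (r : R)
    (u v : Y) (C : {set 'I_n}) (p q : {ffun 'I_n -> 'I_n}) :
  {in C &, forall i j : 'I_n, (i < j)%N -> (p i < p j)%N} ->
  {in C &, forall i j : 'I_n, (i < j)%N -> (q i < q j)%N} ->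
  {in C, forall i : 'I_n, mdist (iter (p i) S u) (iter (q i) S v) < r} ->
  exists (D : {set 'I_n}) (s : {ffun 'I_n -> 'I_n}),
    is_match S r u v D s /\ #|D| = #|C|.
Proof.
move=> mp mq h; have ip := ord_mono_inj mp.
pose s := [ffun j =>
  if [pick i | (i \in C) && (p i == j)] is Some i then q i else j].
have sE i : i \in C -> s (p i) = q i.
  move=> iC; rewrite ffunE; case: pickP => [k /andP[kC /eqP pk]|/(_ i)].
    by rewrite (ip k i).
  by rewrite iC eqxx.
exists (imset p (mem C)), s; split; last by rewrite card_in_imset.
apply/is_matchP; split => [_ _ /imsetP[i iC ->] /imsetP[j jC ->]|_ /imsetP[i iC ->]];
  rewrite !sE//; last exact: h.
(* [p] reflects the order of [C], since it is strictly increasing there. *)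
case: (ltngtP i j) => [ij _|ji|/val_inj ->]; first exact: mq.
- by move=> pij; have := mp _ _ jC iC ji; rewrite ltnNge (ltnW pij).
- by rewrite ltnn.
Qed.

Definition visits {E : Type} (T : E -> E) (B : set E) (n : nat) (x : E) : nat :=
  #|[set i : 'I_n | `[< B (iter i T x) >] ]%SET|.

(** Among the [n] times, [D] and [D'] overlap in at least [#|D| + #|D'| - n]; by
    injectivity of [p] and [q], discarding the times sent into [B] or [B'] costs
    at most [#|B| + #|B'|]. *)
Lemma card_cospan n (D D' B B' : {set 'I_n}) (p q : 'I_n -> 'I_n) :
  {in D &, injective p} -> {in D' &, injective q} ->
  (#|D| + #|D'| <= n + (#|B| + #|B'|) +
     #|[set i in D :&: D' | (p i \notin B) && (q i \notin B')]%SET|)%N.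
Proof.
move=> ip iq.
set C := [set i in _ | _]%SET.
have le1 : (#|[set i in D | p i \in B]%SET| <= #|B|)%N.
  rewrite -(@card_in_imset _ _ p); last first.
    by move=> i j; rewrite !inE => /andP[iD _] /andP[jD _]; exact: ip.
  apply/subset_leq_card/fintype.subsetP => _ /imsetP[i + ->].
  by rewrite inE => /andP[].
have le2 : (#|[set i in D' | q i \in B']%SET| <= #|B'|)%N.
  rewrite -(@card_in_imset _ _ q); last first.
    by move=> i j; rewrite !inE => /andP[iD _] /andP[jD _]; exact: iq.
  apply/subset_leq_card/fintype.subsetP => _ /imsetP[i + ->].
  by rewrite inE => /andP[].
rewrite -cardsUI.
have leU : (#|D :|: D'| <= n)%N by rewrite -[X in (_ <= X)%N](card_ord n) max_card.
rewrite -addnA leq_add// addnC.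
have sub : D :&: D' \subset
    C :|: ([set i in D | p i \in B]%SET :|: [set i in D' | q i \in B']%SET).
  apply/fintype.subsetP => i; rewrite !inE => /andP[-> ->] /=.
  by case: (p i \in B); case: (q i \in B').
apply: leq_trans (subset_leq_card sub) _.
apply: leq_trans (leq_card_setU _ _) _; rewrite leq_add2l.
by apply: leq_trans (leq_card_setU _ _) _; rewrite leq_add.
Qed.

(** A point [c] mediates between [z] and [x], although nothing is known about
    the position of the orbit of [c] relative to [K] or about its image: [c]
    only indexes the pairs of times that are matched. The triangle inequality
    through [c] doubles the scale, and the restrictions to the common times and
    to [K] lose at most the proportion [2 * e + 2 * th]. *)
Lemma dFK_transfer {R : realType} {X Y : pmetricType R} (T : X -> X) (S : Y -> Y)
    (phi : X -> Y) (K : set X) (dl r r' e th : R) n (c z x : X) : (0 < n)%N ->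
  (forall k, phi (iter k T z) = iter k S (phi z)) ->
  (forall k, phi (iter k T x) = iter k S (phi x)) ->
  (forall i j, K (iter i T z) -> K (iter j T x) ->
     mdist (iter i T z) (iter j T x) < dl ->
     mdist (phi (iter i T z)) (phi (iter j T x)) < r) ->
  (visits T (~` K) n z)%:R < th * n%:R -> (visits T (~` K) n x)%:R < th * n%:R ->
  0 < r -> r < r' -> 2 * e <= dl -> 2 * e + 2 * th <= r ->
  dFK T n c z < e -> dFK T n c x < e -> dFK S n (phi z) (phi x) < r'.
Proof.
move=> n0 ez ex hK vz vx r0 rr' edl er.
move=> /(dFK_ltP _ _ _ _ n0)[d [D [p [d0 de /is_matchP[mp dp] cD]]]].
move=> /(dFK_ltP _ _ _ _ n0)[d' [D' [q [d'0 d'e /is_matchP[mq dq] cD']]]].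
have nR : 0 < n%:R :> R by rewrite ltr0n.
pose B := [set i : 'I_n | `[< (~` K) (iter i T z) >] ]%SET.
pose B' := [set i : 'I_n | `[< (~` K) (iter i T x) >] ]%SET.
pose C := [set i in D :&: D' | (p i \notin B) && (q i \notin B')]%SET.
have [|||D2 [s [m2 c2]]] := @match_cospan R Y S n r (phi z) (phi x) C p q.
- by move=> i j; rewrite !inE => /andP[/andP[iD _] _] /andP[/andP[jD _] _]; exact: mp.
- by move=> i j; rewrite !inE => /andP[/andP[_ iD] _] /andP[/andP[_ jD] _]; exact: mq.
- move=> i; rewrite !inE => /andP[/andP[iD iD']] /andP[/asboolPn iB /asboolPn iB'].
  rewrite -ez -ex; apply: hK; [exact: contrapT|exact: contrapT|].
  apply: le_lt_trans (metric_triangle _ (iter i T c) _) _.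
  by rewrite metric_sym; have := dp _ iD; have := dq _ iD'; lra.
apply/(dFK_ltP _ _ _ _ n0); exists r, D2, s; split => //.
have := card_cospan B B' (ord_mono_inj mp) (ord_mono_inj mq).
rewrite -/C c2 -(ler_nat R) !natrD.
rewrite -[#|B|]/(visits T (~` K) n z) -[#|B'|]/(visits T (~` K) n x).
nra.
Qed.

(** * Lusin's theorem at a fixed scale *)

(** Continuity from above of the finite measure [mu] along [A `\` B n], whose
    intersection is empty. *)
Lemma exhaustion_small_remainder {d} {E : measurableType d} {R : realType}
    (mu : probability E R) (A : set E) (B : (set E)^nat) (e : R) :
  measurable A -> (forall n, measurable (B n)) ->
  (forall n m, (n <= m)%N -> B n `<=` B m) -> A `<=` \bigcup_n B n -> 0 < e ->
  exists n, (mu (A `\` B n) < e%:E)%E.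
Proof.
move=> mA mB ndB AB e0.
have mD n : measurable (A `\` B n) by exact: measurableD.
have I0 : \bigcap_n (A `\` B n) = set0.
  rewrite -subset0 => x h; have [Ax _] := h 0%N I.
  by have [n _ Bnx] := AB x Ax; have [_] := h n I.
have : (mu \o (fun n => A `\` B n)) n @[n --> \oo] --> mu (\bigcap_n (A `\` B n)).
  apply: nonincreasing_cvg_mu => //.
  - by rewrite (le_lt_trans (probability_le1 mu (mD 0%N)))// ltry.
  - exact: bigcap_measurable.
  - by move=> n m nm; apply/subsetPset => x [Ax nBx]; split => // /(ndB _ _ nm).
rewrite I0 measure0 => /(_ [set y | (y < e%:E)%E]) [].
  by apply: open_nbhs_nbhs; split => //=; exact: open_ereal_lt_ereal.
by move=> n _ /(_ n (leqnn n)); exists n.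
Qed.

Section uniformly_separated.
Context {R : realType} {X : pmetricType R}.
Variable mu : probability (borel X) R.

(** Up to measure [e], the indicators of the sets [A i], [i] in [s], are locally
    constant at a uniform scale [dl]; by symmetry of the distance one
    implication is enough. In this form of regularity, sets are not approximated
    by closed and open ones, and the class is visibly stable under
    complement. *)
Definition almost_uniform (I : eqType) (s : seq I) (A : I -> set X) : Prop :=
  forall e : R, 0 < e -> exists (K : set (borel X)) (dl : R),
    [/\ measurable K, 0 < dl, (mu (~` K) < e%:E)%E &
      forall x y, K x -> K y -> mdist x y < dl ->
        {in s, forall i, A i x -> A i y}].

(** Finitely many sets are handled at once by intersecting the sets [K] and
    taking the smallest scale. *)
Lemma almost_uniform_family (I : eqType) (s : seq I) (A : I -> set X) :
  {in s, forall i, almost_uniform [:: i] A} -> almost_uniform s A.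
Proof.
elim: s => [_ e e0|i s IH h e e0].
  by exists setT, 1; split => //; rewrite setCT measure0.
have e2 : 0 < e / 2 by rewrite divr_gt0.
have [K [dl [mK dl0 muK hK]]] := h i (mem_head _ _) _ e2.
have /(_ _ e2)[L [dl' [mL dl'0 muL hL]]] : almost_uniform s A.
  by apply: IH => j js; apply: h; rewrite inE js orbT.
exists (K `&` L), (Num.min dl dl'); split.
- exact: measurableI.
- by rewrite lt_min dl0.
- rewrite setCI; apply: le_lt_trans (measureU2 _ _ _) _; try exact: measurableC.
  by rewrite (splitr e) EFinD lteD.
- move=> x y [Kx Lx] [Ky Ly]; rewrite lt_min => /andP[d1 d2] j.
  rewrite inE => /predU1P[->|js]; first by apply: hK; rewrite ?mem_head.
  exact: hL.
Qed.

Definition almost_uniform_set (A : set X) := almost_uniform [:: tt] (fun=> A).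

Lemma almost_uniform_setE (I : eqType) (A : I -> set X) (i : I) :
  almost_uniform_set (A i) -> almost_uniform [:: i] A.
Proof.
move=> h e /h[K [dl [mK dl0 muK hK]]]; exists K, dl; split => // x y Kx Ky xy j.
by rewrite inE => /eqP ->; apply: (hK x y Kx Ky xy tt); rewrite inE.
Qed.

(** The points of [O] at distance at least [1 / (n + 1)] from the complement
    exhaust [O]. Once the remaining part of [O] is removed, points at distance
    less than [1 / (n + 1)] are both in [O] or both outside. *)
Lemma almost_uniform_open (O : set X) : open O -> almost_uniform_set O.
Proof.
move=> oO e e0.
pose B n : set (borel X) := [set x | [set y | mdist x y < n.+1%:R^-1] `<=` O].
(* The complement of [B n] is a union of balls centred outside [O]; this gives
   the measurability of [B n]. *)
have oC n : open (~` B n).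
  rewrite (_ : ~` B n = \bigcup_(y in ~` O) [set x | mdist y x < n.+1%:R^-1]).
    by apply: bigcup_open => y _; exact: open_mdist_lt.
  apply/seteqP; split => [x /= /existsNP[y /not_implyP[xy Oy]]|x [y Oy /= yx] /= h].
    by exists y => //=; rewrite metric_sym.
  by apply/Oy/h => /=; rewrite metric_sym.
have mO : measurable (O : set (borel X)) by exact: sub_sigma_algebra.
have mB n : measurable (B n).
  by rewrite -(setCK (B n)); apply: measurableC; exact: sub_sigma_algebra (oC n).
have [n m nm|x Ox|n hn] := @exhaustion_small_remainder _ _ _ mu O B e mO mB _ _ e0.
- move=> x Bx y /= xy; apply: Bx => /=; apply: lt_le_trans xy _.
  by rewrite lef_pV2 ?posrE// ler_nat.
- have /nbhs_ballP[r /= r0 rO] := @open_nbhs_nbhs X x O (conj oO Ox).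
  have [k kr] : exists k, k.+1%:R^-1 < r.
    by have [k _ /(_ k (leqnn k)) /=] := near_infty_natSinv_lt (PosNum r0); exists k.
  exists k => // y /= xy; apply: rO; rewrite ballEmdist /=; exact: lt_trans kr.
- exists (~` (O : set (borel X)) `|` B n), n.+1%:R^-1; split.
  + by apply: measurableU => //; exact: measurableC.
  + by rewrite invr_gt0.
  + by rewrite setCU setCK.
  + by move=> x y [nO|Bx] _ xy _ _ Ox; [case: nO|exact: Bx].
Qed.

(** The sets with this property form a sigma-algebra: for a countable union,
    replace it by a finite subunion and remove the small difference of the
    two. *)
Lemma almost_uniform_measurable (A : set (borel X)) :
  measurable A -> almost_uniform_set A.
Proof.
move=> mA; suff [] : measurable A /\ almost_uniform_set A by [].
move: A mA; apply: (@smallest_sub _ (sigma_algebra setT)); last first.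
  move=> A oA; split; [exact: sub_sigma_algebra|exact: almost_uniform_open].
split.
- split => // e e0; exists setT, 1.
  by split => //; [rewrite setCT measure0|move=> x y _ _ _ i _].
- move=> A [mA hA]; rewrite setTD; split; first exact: measurableC.
  move=> e /hA[K [dl [mK dl0 muK hK]]]; exists K, dl; split => //.
  move=> x y Kx Ky xy i ii nAx Ay; apply: nAx.
  by apply: (hK y x Ky Kx _ i ii Ay); rewrite metric_sym.
- move=> A hA; split.
    by apply: bigcup_measurable => n _; have [] := hA n.
  move=> e e0; have e2 : 0 < e / 2 by rewrite divr_gt0.
  pose B n := \bigcup_(i in `I_n) A i.
  have mA n : measurable (A n : set (borel X)) by have [] := hA n.
  have mB n : measurable (B n : set (borel X)) by exact: bigcup_measurable.
  have mU : measurable ((\bigcup_n A n) : set (borel X)) by exact: bigcup_measurable.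
  have [||n hn] := @exhaustion_small_remainder _ _ _ mu _ B _ mU mB _ _ e2.
  + by move=> n m nm x [i /= iN Aix]; exists i => //=; exact: leq_trans nm.
  + by move=> x [n _ Ax]; exists n.+1 => //; exists n => /=.
  have /(_ _ e2)[K [dl [mK dl0 muK hK]]] : almost_uniform (iota 0 n) A.
    by apply: almost_uniform_family => i _; apply: almost_uniform_setE; have [] := hA i.
  exists (K `&` ~` ((\bigcup_n A n) `\` B n)), dl; split => //.
  + by apply: measurableI => //; apply/measurableC/measurableD.
  + rewrite setCI setCK; apply: le_lt_trans (measureU2 _ _ _) _.
    * exact: measurableC.
    * exact: measurableD.
    * by rewrite [e in X in (_ < X)%E]splitr EFinD lteD.
  + move=> x y [Kx nx] [Ky ny] xy _ _ Ux.
    have [i /= iN Aix] : B n x by apply: contrapT => nBx; apply: nx.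
    by exists i => //; apply: (hK x y Kx Ky xy i) => //; rewrite mem_iota.
Qed.

End uniformly_separated.

(** By compactness, [Y] is a finite union of balls of radius [r / 2]. The
    preimages of these balls are made locally constant at scale [dl] at once, so
    that nearby points of [K] have images in a common ball. *)
Lemma almost_uniformly_close {R : realType} {X Y : pmetricType R}
    (mu : probability (borel X) R) (E : set (borel X)) (phi : X -> Y) (r e : R) :
  compact [set: Y] -> measurable E ->
  measurable_fun E (phi : borel X -> borel Y) -> 0 < r -> 0 < e ->
  exists (K : set (borel X)) (dl : R),
    [/\ measurable K, 0 < dl, (mu (~` K) < e%:E)%E &
      forall x y, E x -> E y -> K x -> K y -> mdist x y < dl ->
        mdist (phi x) (phi y) < r].
Proof.
move=> cY mE mphi r0 e0; have r2 : 0 < r / 2 by rewrite divr_gt0.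
pose f y0 : set Y := [set y | mdist y0 y < r / 2].
move: cY; rewrite compact_cover => /(_ Y setT f) [].
- by move=> y0 _; exact: open_mdist_lt.
- by move=> y _; exists y => //; rewrite /f /= mdistxx.
move=> D _ Dcov.
have [i iD||K [dl [mK dl0 muK hK]]] :=
  @almost_uniform_family _ _ mu _ (finmap.enum_fset D) (fun y0 => E `&` phi @^-1` f y0) _ e.
- apply: almost_uniform_setE; apply: almost_uniform_measurable.
  by apply: mphi => //; apply: sub_sigma_algebra; exact: open_mdist_lt.
- exact: e0.
exists K, dl; split => // x y Ex Ey Kx Ky xy.
have [y0 /= y0D fx] := Dcov (phi x) I.
have [_ fy] := hK x y Kx Ky xy y0 y0D (conj Ex fx).
apply: le_lt_trans (metric_triangle _ y0 _) _.
rewrite (splitr r) ltrD//; first by rewrite metric_sym.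
Qed.

(** * Visits of orbits to a set of small measure *)

Lemma invariant_iter {d} {E : measurableType d} {R : realType} (T : E -> E)
    (mu : probability E R) (mT : measurable_fun setT T) k :
  invariant_measure T mu -> measurable_fun setT (iter k T) /\
  forall A, measurable A -> mu (iter k T @^-1` A) = mu A.
Proof.
move=> invT; elim: k => [|k [mk IH]]; first by split; [exact: measurable_id|].
split; first exact: (measurableT_comp mT mk).
move=> A mA; rewrite -(invT A mA).
rewrite -[LHS]/(mu (iter k T @^-1` (T @^-1` A))) IH//.
by rewrite -[X in measurable X]setTI; exact: mT.
Qed.

(** Markov's inequality for the number of visits, a sum of [n] indicators which
    each have integral [mu B] by invariance. *)
Lemma measure_many_visits {d} {E : measurableType d} {R : realType} (T : E -> E)
    (mu : probability E R) (B : set E) n (th : R) :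
  measurable_fun setT T -> invariant_measure T mu -> measurable B ->
  (0 < n)%N -> 0 < th ->
  let M := [set x | th * n%:R <= (visits T B n x)%:R] in
  measurable M /\ (th%:E * mu M <= mu B)%E.
Proof.
move=> mT invT mB n0 th0 M; have nR : 0 < n%:R :> R by rewrite ltr0n.
pose f (i : 'I_n) x : \bar R := (\1_(iter i T @^-1` B) x)%:E.
have mP (i : 'I_n) : measurable (iter i T @^-1` B).
  have [mi _] := invariant_iter mT i invT.
  by rewrite -[X in measurable X]setTI; exact: mi.
have mf i : measurable_fun setT (f i).
  by apply/measurable_EFinP; exact: measurable_indic.
pose g x := (\sum_(i < n) f i x)%E.
have gE x : g x = ((visits T B n x)%:R)%:E.
  rewrite /g /f sumEFin /visits -sum1dep_card natr_sum [in RHS]big_mkcond /=.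
  congr (_%:E); apply: eq_bigr => i _; rewrite indicE.
  by case: asboolP => h; [rewrite mem_set|rewrite memNset].
have mg : measurable_fun setT g by exact: emeasurable_sum.
have ME : M = [set x | ((th * n%:R)%:E <= `|g x|)%E].
  by apply/seteqP; split => x /=; rewrite gE gee0_abs ?lee_fin.
have a0 : 0 < th * n%:R by rewrite mulr_gt0.
have ig : (\int[mu]_x g x = n%:R%:E * mu B)%E.
  rewrite ge0_integral_sum//; last by move=> i x _; rewrite lee_fin.
  rewrite (eq_bigr (fun=> mu B)); last first.
    move=> i _; rewrite integral_indic// setIT.
    by have [_] := invariant_iter mT i invT; apply.
  by rewrite -(fineK (fin_num_measure mu _ mB)) sumEFin sumr_const card_ord -EFinM mulr_natl.
have mM : measurable M.
  by rewrite ME -[X in measurable X]setTI;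
    apply: emeasurable_fun_c_infty => //; exact: measurableT_comp.
split => //.
have := @le_integral_comp_abse _ _ _ mu setT measurableT g _ id
  (@measurable_id _ _ _) (fun r h => h) (fun x y _ _ h => h) mg a0.
rewrite setTI -ME; under eq_integral do rewrite gee0_abs ?gE ?lee_fin//.
under eq_integral do rewrite -gE.
by rewrite ig EFinM -muleA muleCA lee_pmul2l.
Qed.

(** * Transfer of the FK-complexity along an isomorphism *)

Lemma continuous_borel_measurable {X Y : ptopologicalType} (f : X -> Y) :
  continuous f -> measurable_fun setT (f : borel X -> borel Y).
Proof.
move=> cf; apply: (@measurability _ _ (borel X) (borel Y) setT f (@open Y)) => //.
move=> _ [V oV <-]; rewrite setTI; apply: sub_sigma_algebra.
by move/continuousP: cf; apply.
Qed.

(** The budget: [th = e / 8] is the tolerated proportion of times outside [K],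
    and [mu (~` K) < th * th] makes the set of points that exceed it of measure
    at most [th]. With [e' <= e / 8] a match loses at most the proportion
    [2 * e' + 2 * th <= e / 2], and the covered measure decreases by at most
    [th], with [e' + th <= e]. *)
Lemma FK_spanned_transfer {R : realType} {X Y : pmetricType R}
    (T : X -> X) (mu : probability (borel X) R)
    (S : Y -> Y) (nu : probability (borel Y) R) :
  continuous T -> invariant_measure (T : borel X -> borel X) mu ->
  compact [set: Y] -> continuous S ->
  measurably_isomorphic (T : borel X -> borel X) mu (S : borel Y -> borel Y) nu ->
  forall e : R, 0 < e -> exists e' : R, 0 < e' /\
    forall n m, (0 < n)%N -> FK_spanned_by T mu n e' m -> FK_spanned_by S nu n e m.
Proof.
move=> cT invT cY cS [E [F [[mE mF] [muE nuF] [TE SF]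
  [phi [psi [[EF mphi muphi] _ _ _ eqv]]]]]] e e0.
pose th := e / 8; have th0 : 0 < th by rewrite divr_gt0.
have e2 : 0 < e / 2 by rewrite divr_gt0.
have [K [dl [mK dl0 muK hK]]] :=
  @almost_uniformly_close _ X Y mu E phi _ _ cY mE mphi e2 (mulr_gt0 th0 th0).
pose e' := Num.min (dl / 2) (e / 8).
have e'0 : 0 < e' by rewrite lt_min !divr_gt0.
have e'dl : 2 * e' <= dl by rewrite -ler_pdivlMl// mulrC ge_min lexx.
have e'e : e' <= e / 8 by rewrite ge_min lexx orbT.
exists e'; split => // n m n0 [m0 [c hc]]; split => //.
have mT := continuous_borel_measurable cT.
have [mM muM] := measure_many_visits mT invT (measurableC mK) n0 th0.
set M := [set x | _] in mM muM.
have {}muM : (mu M <= th%:E)%E.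
  rewrite -(@lee_pmul2l _ th%:E)// ?lte_fin//.
  by apply: le_trans muM _; rewrite -EFinM ltW.
(* A ball without good points covers nothing that has to be covered, and its
   new centre is arbitrary. *)
pose z i := xget point (ballFK T n (c i) e' `&` (E `&` ~` M)).
exists (phi \o z).
set V := \bigcup_i _; set W := \bigcup_i _ in hc.
have mV : measurable (V : set (borel Y)).
  by apply: sub_sigma_algebra; apply: bigcup_open => i _; exact: open_ballFK.
have mW : measurable (W : set (borel X)).
  by apply: sub_sigma_algebra; apply: bigcup_open => i _; exact: open_ballFK.
have iterE k x : E x -> E (iter k T x) /\ phi (iter k T x) = iter k S (phi x).
  move=> Ex; elim: k => [|k [Ek pk]] //=; rewrite -pk; split; first by apply: TE; exists (iter k T x).
  by rewrite eqv// inE.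
have visitE x : ~ M x -> (visits T (~` K) n x)%:R < th * n%:R.
  by move/negP; rewrite -ltNge.
(* The points of [W] whose image is not known to be covered are those outside
   the domain of the isomorphism and those with many visits outside [K]. *)
have WV : W `<=` (E `&` phi @^-1` (V `&` F)) `|` (~` E `|` M).
  move=> x [i _ xi]; have [Ex|nEx] := pselect (E x); last by right; left.
  have [Mx|nMx] := pselect (M x); [by right; right|left; split => //].
  split; last exact: EF.
  exists i => //; have [zi [Ez nMz]] : (ballFK T n (c i) e' `&` (E `&` ~` M)) (z i).
    by apply: xgetPex; exists x.
  apply: (@dFK_transfer _ _ _ T S phi K dl (e / 2) e e' th n (c i) (z i) x) => //.
  - by move=> k; have [] := iterE k (z i) Ez.
  - by move=> k; have [] := iterE k x Ex.
  - move=> a b Ka Kb; apply: hK => //.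
      by have [] := iterE a (z i) Ez.
    by have [] := iterE b x Ex.
  - exact: visitE.
  - exact: visitE.
  - by lra.
  - by rewrite /th; lra.
have mphiV : measurable (E `&` phi @^-1` (V `&` F)) by apply: mphi => //; exact: measurableI.
have mEM : measurable (~` E `|` M) by apply: measurableU => //; exact: measurableC.
have muWV : (mu W <= nu V + th%:E)%E.
  apply: (@le_trans _ _ (mu (E `&` phi @^-1` (V `&` F)) + mu (~` E `|` M))%E).
    apply: le_trans (measureU2 _ _ _) => //.
    by apply: le_measure => //; rewrite inE//; exact: measurableU.
  apply: leeD.
    rewrite muphi//; last exact: measurableI.
    by apply: le_measure; rewrite ?inE//; exact: measurableI.
  have muEc : mu (~` E) = 0%E by rewrite probability_setC// muE subee.
  apply: le_trans (measureU2 _ (measurableC mE) mM) _.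
  by rewrite -[leRHS]add0e leeD// -muEc.
have : ((1 - e')%:E < nu V + th%:E)%E by exact: lt_le_trans hc muWV.
rewrite -lteBlDr// -EFinB; apply: le_lt_trans.
by rewrite lee_fin /th; lra.
Qed.

(** To get the conjugacy relation for [psi], apply [psi] to
    [S y = phi (T (psi y))]: as [E'] is forward invariant, [T (psi y)] is a point
    where [psi] inverts [phi]. *)
Lemma measurably_isomorphic_sym {d d'} {E : measurableType d}
    {F : measurableType d'} {R : realType} (T : E -> E) (mu : probability E R)
    (S : F -> F) (nu : probability F R) :
  measurably_isomorphic T mu S nu -> measurably_isomorphic S nu T mu.
Proof.
move=> [E' [F' [[mE mF] [muE nuF] [TE SF] [phi [psi [h1 h2 K1 K2 eqv]]]]]].
exists F', E'; split => //; exists psi, phi; split => // y yF.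
have [FE _ _] := h2.
have yE : psi y \in E' by rewrite inE; apply: FE; rewrite -inE.
rewrite -{1}(K2 y yF) -eqv// K1// inE; apply: TE.
by exists (psi y) => //; rewrite -inE.
Qed.

(** The inequality is only required for [n > 0], because complexities are only
    compared there; lower limits ignore the remaining term. *)
Lemma limn_einf_squeeze0 {R : realType} (u v : (\bar R)^nat) :
  (forall n, 0 <= v n)%E -> (forall n, (0 < n)%N -> v n <= u n)%E ->
  limn_einf u = 0%E -> limn_einf v = 0%E.
Proof.
move=> v0 vu; rewrite !limn_einf_lim => u0; apply/eqP; rewrite eq_le; apply/andP; split.
  rewrite -u0; apply: lee_lim; [exact: is_cvg_einfs|exact: is_cvg_einfs|].
  near=> n; apply/ereal_infP => _ [k /= nk <-].
  apply: (@le_trans _ _ (v k)); first by apply: ereal_inf_lbound; exists k.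
  by apply: vu; apply: leq_trans nk; near: n; exists 1%N.
apply: lime_ge; first exact: is_cvg_einfs.
by apply: nearW => n; apply/ereal_infP => _ [k _ <-].
Unshelve. all: by end_near. Qed.

Lemma FK_weaker_than_transfer {R : realType} {X Y : pmetricType R}
    (T : X -> X) (mu : probability (borel X) R)
    (S : Y -> Y) (nu : probability (borel Y) R) (U : nat -> R) :
  continuous T -> invariant_measure (T : borel X -> borel X) mu ->
  compact [set: Y] -> continuous S ->
  measurably_isomorphic (T : borel X -> borel X) mu (S : borel Y -> borel Y) nu ->
  (forall n, 0 < U n) -> FK_weaker_than T mu U -> FK_weaker_than S nu U.
Proof.
move=> cT invT cY cS iso U0 wX e e0.
have [e' [e'0 he']] := FK_spanned_transfer cT invT cY cS iso e0.
apply: limn_einf_squeeze0 (wX e' e'0) => n => [|n0].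
  apply: mule_ge0; last by rewrite lee_fin invr_ge0 ltW.
  by apply/ereal_infP => _ [m _ <-]; rewrite lee_fin.
apply: lee_wpmul2r; first by rewrite lee_fin invr_ge0 ltW.
apply: ereal_inf_le_tmp => _ [m hm <-]; exists m => //; exact: he'.
Qed.

Theorem proposition2p14 (R : realType)
  (X : pmetricType R) (T : X -> X) (mu : probability (borel X) R)
  (Y : pmetricType R) (S : Y -> Y) (nu : probability (borel Y) R)
  (U : nat -> R)
  (cptX : compact [set: X]) (cT : continuous T) (invmu : invariant_measure (T : borel X -> borel X) mu)
  (cptY : compact [set: Y]) (cS : continuous S) (invnu : invariant_measure (S : borel Y -> borel Y) nu)
  (iso : measurably_isomorphic (T : borel X -> borel X) mu (S : borel Y -> borel Y) nu)
  (U_ge1 : forall n, 1 <= U n) (U_incr : nondecreasing_seq U)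
  (U_oo : U n @[n --> \oo] --> +oo) :
  FK_weaker_than T mu U <-> FK_weaker_than S nu U.
Proof.
have U0 n : 0 < U n by exact: lt_le_trans (U_ge1 n).
split; first exact: FK_weaker_than_transfer.
by apply: FK_weaker_than_transfer => //; exact: measurably_isomorphic_sym.
Qed.
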